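(* (i) For each $\epsilon>0$ let $\overline u_\epsilon$ be the (unique, radially symmetric) solution of the Dirichlet problem $$\Delta \overline u_\epsilon=\epsilon^{-2}\bigl(e^{\overline u_\epsilon}-r^2e^{-\overline u_\epsilon}\bigr)\ \text{ in } B_1(0),\qquad \overline u_\epsilon=0\ \text{ on }\partial B_1(0),$$ regarded as a function $\overline u_\epsilon(r)$ of $r=|x|$. Then for every integer $k\ge 0$ there exist constants $C_k,c_k>0$, independent of $\epsilon$, such that for all sufficiently small $\epsilon>0$ $$\|\overline u_\epsilon-\ln r\|_{C^k([1/2,1])}\le C_k e^{-c_k/\epsilon}.$$ (ii) Fix $r_0>0$. For each $\epsilon>0$ let $u_\epsilon$ be the (unique, radially symmetric) solution of the Dirichlet problem $$\Delta u_\epsilon=4\pi^2\epsilon^{-2}\bigl(e^{2u_\epsilon}-r^2e^{-2u_\epsilon}\bigr)\ \text{ in } B_{2r_0}(0),\qquad u_\epsilon=\tfrac12\ln(2r_0)\ \text{ on }\partial B_{2r_0}(0),$$ regarded as a function $u_\epsilon(r)$ of $r=|x|$. Then for every integer $k\ge0$ there exist constants $C_k,c_k>0$, independent of $\epsilon$ (but possibly depending on $r_0$), such that for all sufficiently small $\epsilon>0$ $$\Bigl\|u_\epsilon-\tfrac12\ln r\Bigr\|_{C^k([r_0,2r_0])}\le C_k e^{-c_k/\epsilon}.$$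
   Context: $B_R(0)\subset\mathbb R^2$ is the open disc of radius $R$ centred at the origin, $r=|x|=\sqrt{x_1^2+x_2^2}$, and $\Delta=\partial_{x_1}^2+\partial_{x_2}^2$. Solutions are classical: $C^2$ in the open disc and continuous on the closed disc. Each of the two Dirichlet problems has a unique such solution, and by uniqueness it is radially symmetric, so it is identified with a function of $r$. For an interval $[a,b]$, $\|f\|_{C^k([a,b])}=\sum_{j=0}^k\sup_{[a,b]}|f^{(j)}|$, derivatives being taken with respect to $r$. *)

(* Defs.v *)
From Stdlib Require Export Reals.
From Coquelicot Require Export Coquelicot.
Open Scope R_scope.

Definition rad (x1 x2 : R) : R := sqrt (x1 ^ 2 + x2 ^ 2).

Definition laplacian (U : R -> R -> R) (x1 x2 : R) : R :=
  partial_derive 2 0 U x1 x2 + partial_derive 0 2 U x1 x2.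

(* Laplacian U = F(|x|, U) in the disc of radius rho about 0, U = b on its
   boundary.  Only the values of U on the closed disc matter. *)
Record classical_dirichlet_solution
    (rho : R) (F : R -> R -> R) (b : R) (U : R -> R -> R) : Prop := {
  cds_C2 : forall x1 x2, rad x1 x2 < rho -> ex_diff_n U 2 x1 x2;
  cds_continuous :
    continuous_on (fun p : R * R => rad (fst p) (snd p) <= rho)
                  (fun p : R * R => U (fst p) (snd p));
  cds_equation :
    forall x1 x2, rad x1 x2 < rho ->
      laplacian U x1 x2 = F (rad x1 x2) (U x1 x2);
  cds_boundary : forall x1 x2, rad x1 x2 = rho -> U x1 x2 = b
}.

Definition radial_dirichlet_solution
    (rho : R) (F : R -> R -> R) (b : R) (u : R -> R) : Prop :=
  classical_dirichlet_solution rho F b (fun x1 x2 => u (rad x1 x2)).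

(* f is C^k on [a,b], with g j its j-th derivative there for j <= k.
   Derivatives are relative to [a,b], hence one-sided at the endpoints: when
   [a,b] reaches the boundary radius rho, the profile is arbitrary beyond b. *)
Definition is_Ck_on (k : nat) (a b : R) (f : R -> R) (g : nat -> R -> R) : Prop :=
  let I := fun x => a <= x <= b in
  (forall x, I x -> g 0%nat x = f x) /\
  (forall j x, (j < k)%nat -> I x -> D_in (g j) (g (S j)) I x) /\
  continuous_on I (g k).

(* f is C^k on [a,b] and its C^k norm is N. *)
Definition is_Ck_norm (k : nat) (a b : R) (f : R -> R) (N : R) : Prop :=
  exists (g : nat -> R -> R) (s : nat -> R),
    is_Ck_on k a b f g /\
    (forall j, (j <= k)%nat ->
       is_lub (fun y => exists x, a <= x <= b /\ y = Rabs (g j x)) (s j)) /\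
    N = sum_f_R0 s k.

(* Main.v *)
Require Import Defs.
From Stdlib Require Import Reals Lra Lia.
From Coquelicot Require Import Coquelicot.
Open Scope R_scope.

(** Write [v = u] in the first problem and [v = 2 u] in the second, and
    [w = v - ln r].  Since [ln r] is harmonic away from 0, [w] satisfies
    [w'' + w'/r = lam r (e^w - e^-w)] with [lam] of order [eps^-2], [w = 0] on the
    boundary circle [r = rho], and [w -> +oo] at the centre.  The maximum principle gives [w >= 0];
    hence [r v'] is nondecreasing, [v] is nondecreasing, and
    [w <= ln (rho / r)], a bound independent of [eps] away from 0.  Comparison
    with [ln 4 exp (- a (r - rho/4))], [a ~ 1/eps], makes [w] exponentially small
    on [3 rho/8, rho], and integrating the equation does the same for [w'].  Every
    higher derivative is a polynomial in [lam], [r], [1/r], [w], [w'],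
    [e^w - e^-w], [e^w + e^-w], each monomial of which has an exponentially small
    factor, while [lam] grows only polynomially in [1/eps]. *)

(** * The radial equation *)

Lemma is_derive_continuity_pt (f : R -> R) (x l : R) :
  is_derive f x l -> continuity_pt f x.
Proof.
  intros H. apply derivable_continuous_pt. exists l. now apply is_derive_Reals.
Qed.

Lemma strict_MVT (f df : R -> R) (a b : R) :
  a < b ->
  (forall x, a < x < b -> is_derive f x (df x)) ->
  (forall x, a <= x <= b -> continuity_pt f x) ->
  exists c, a < c < b /\ f b - f a = df c * (b - a).
Proof.
  intros Hab Hd Hc.
  assert (pr : forall c, a < c < b -> derivable_pt f c).
  { intros c Hcab. exists (df c). now apply is_derive_Reals, Hd. }
  destruct (MVT f id a b pr (fun c _ => derivable_pt_id c)) as [c [P E]]; auto.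
  - intros. apply derivable_continuous, derivable_id.
  - exists c; split; auto.
    rewrite derive_pt_id in E. unfold id in E.
    assert (H : derive_pt f c (pr c P) = df c).
    { apply derive_pt_eq_0. now apply is_derive_Reals, Hd. }
    rewrite H in E. lra.
Qed.

Lemma nonneg_derivative_le (f df : R -> R) (a b : R) :
  a <= b ->
  (forall x, a < x < b -> is_derive f x (df x)) ->
  (forall x, a <= x <= b -> continuity_pt f x) ->
  (forall x, a < x < b -> 0 <= df x) ->
  f a <= f b.
Proof.
  intros Hab Hd Hc Hp.
  destruct (Req_dec a b) as [->|Hne]; [lra|].
  destruct (strict_MVT f df a b) as [c [Hcab E]]; auto; [lra|].
  specialize (Hp c Hcab). nra.
Qed.

Lemma negative_right_of_zero (f : R -> R) (m d : R) :
  is_derive f m d -> d < 0 -> f m = 0 ->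
  exists del, 0 < del /\ forall x, m < x < m + del -> f x < 0.
Proof.
  intros Hd Hneg H0. apply is_derive_Reals in Hd.
  destruct (Hd (- d)) as [del H]; [lra|].
  exists del; split; [apply cond_pos|]. intros x Hx.
  specialize (H (x - m)). rewrite H0 in H.
  replace (m + (x - m)) with x in H by ring.
  assert (Hq : Rabs ((f x - 0) / (x - m) - d) < - d).
  { apply H; [lra|]. rewrite Rabs_pos_eq; lra. }
  apply Rabs_def2 in Hq.
  assert (E : f x = (f x - 0) / (x - m) * (x - m)) by (field; lra).
  rewrite E. nra.
Qed.

(** At a negative interior minimum [f1] vanishes and [f2] is negative, so [f1] is negative just to
    the right and [f] drops below its minimum. Testing [f2] only at critical points lets the
    first-order terms of the equation drop out or become explicit. *)
Lemma minimum_principle (f f1 f2 : R -> R) (a b : R) :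
  (forall x, a <= x <= b -> continuity_pt f x) ->
  (forall x, a < x < b -> is_derive f x (f1 x)) ->
  (forall x, a < x < b -> is_derive f1 x (f2 x)) ->
  0 <= f a -> 0 <= f b ->
  (forall x, a < x < b -> f x < 0 -> f1 x = 0 -> f2 x < 0) ->
  forall x, a <= x <= b -> 0 <= f x.
Proof.
  intros Hc H1 H2 Ha Hb Hcrit x Hx.
  destruct (continuity_ab_min f a b) as [m [Hmin Hm]]; [lra|auto|].
  destruct (Rle_dec 0 (f m)) as [|Hneg]; [specialize (Hmin x Hx); lra|].
  exfalso.
  assert (Hm' : a < m < b).
  { split; apply Rnot_le_lt; intros ?.
    - replace m with a in * by lra; lra.
    - replace m with b in * by lra; lra. }
  assert (H0 : f1 m = 0).
  { assert (pr : derivable_pt f m) by (exists (f1 m); now apply is_derive_Reals, H1).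
    rewrite <- (deriv_minimum f a b m pr); try lra.
    - symmetry. apply derive_pt_eq_0. now apply is_derive_Reals, H1.
    - intros y Hy1 Hy2. apply Hmin. lra. }
  destruct (negative_right_of_zero f1 m (f2 m)) as [del [Hdel Hlt]]; auto.
  { apply Hcrit; auto; lra. }
  (* A point right of [m], close enough for [f1] to be negative on the way and still inside the
     interval. *)
  set (y := m + Rmin (del / 2) ((b - m) / 2)).
  assert (Hy : m < y < m + del /\ y < b).
  { unfold y. generalize (Rmin_l (del / 2) ((b - m) / 2)).
    generalize (Rmin_r (del / 2) ((b - m) / 2)).
    generalize (Rmin_glb_lt (del / 2) ((b - m) / 2) 0). lra. }
  destruct (strict_MVT f f1 m y) as [c [Hcy E]]; try lra.
  - intros z Hz. apply H1. lra.
  - intros z Hz. apply Hc. lra.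
  - assert (f1 c < 0) by (apply Hlt; lra).
    assert (f m <= f y) by (apply Hmin; lra). nra.
Qed.

(* [r = |x|], and [v] solves [v'' + v'/r = lam (e^v - r^2 e^-v)]; [v1] is [v'].
   Both problems have this form, with [v = u] and [v = 2 u] respectively. *)
Record is_profile (rho lam : R) (v v1 : R -> R) : Prop := {
  profile_continuous : forall x, continuity_pt v x;
  profile_derive : forall r, 0 < r < rho -> is_derive v r (v1 r);
  profile_equation : forall r, 0 < r < rho ->
    is_derive v1 r (lam * (exp (v r) - r ^ 2 * exp (- v r)) - v1 r / r);
  profile_boundary : v rho = ln rho
}.

(** * Sign, monotonicity and decay of the deviation from the logarithm *)

Definition dev (v : R -> R) (r : R) : R := v r - ln r.

Lemma exp_dev (v : R -> R) (r : R) : 0 < r -> exp (v r) = r * exp (dev v r).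
Proof.
  intros Hr. unfold dev. rewrite <- (exp_ln r Hr) at 2.
  rewrite <- exp_plus. f_equal. ring.
Qed.

Lemma exp_opp_dev (v : R -> R) (r : R) :
  0 < r -> r ^ 2 * exp (- v r) = r * exp (- dev v r).
Proof.
  intros Hr. unfold dev.
  replace (- (v r - ln r)) with (ln r + - v r) by ring.
  rewrite exp_plus, exp_ln by easy. ring.
Qed.

Lemma dev_continuity_pt (rho lam : R) (v v1 : R -> R) (r : R) :
  is_profile rho lam v v1 -> 0 < r -> continuity_pt (dev v) r.
Proof.
  intros Hp Hr. unfold dev. apply continuity_pt_minus.
  - apply (profile_continuous _ _ _ _ Hp).
  - apply (is_derive_continuity_pt _ _ (/ r)). now apply is_derive_ln.
Qed.

Lemma dev_derive (rho lam : R) (v v1 : R -> R) (r : R) :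
  is_profile rho lam v v1 -> 0 < r < rho -> is_derive (dev v) r (v1 r - / r).
Proof.
  intros Hp Hr. unfold dev. apply (is_derive_minus (V := R_NormedModule)).
  - now apply (profile_derive _ _ _ _ Hp).
  - now apply is_derive_ln.
Qed.

Lemma dev_derive2 (rho lam : R) (v v1 : R -> R) (r : R) :
  is_profile rho lam v v1 -> 0 < r < rho ->
  is_derive (fun s => v1 s - / s) r
    (lam * r * (exp (dev v r) - exp (- dev v r)) - (v1 r - / r) / r).
Proof.
  intros Hp Hr.
  replace (lam * r * _ - _) with
    (lam * (exp (v r) - r ^ 2 * exp (- v r)) - v1 r / r - (- / r ^ 2)).
  - apply (is_derive_minus (V := R_NormedModule)).
    + now apply (profile_equation _ _ _ _ Hp).
    + auto_derive; [lra|]. field. lra.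
  - rewrite exp_dev, exp_opp_dev by lra. field. lra.
Qed.

Lemma dev_nonneg (rho lam : R) (v v1 : R -> R) (r : R) :
  is_profile rho lam v v1 -> 0 < lam -> 0 < r <= rho -> 0 <= dev v r.
Proof.
  intros Hp Hlam Hr.
  destruct (continuity_ab_min v 0 rho) as [m [Hm _]];
    [lra|intros; apply (profile_continuous _ _ _ _ Hp)|].
  (* With [m] a minimum point of [v], this gives [ln d <= v m <= v d]: the deviation is nonnegative
     at [d]. Since [d <= r], the comparison on [[d, rho]] reaches [r]. *)
  set (d := Rmin r (exp (v m))).
  assert (Hd : 0 < d).
  { apply Rmin_glb_lt; [lra|apply exp_pos]. }
  assert (Hdr : d <= r) by apply Rmin_l.
  apply (minimum_principle (dev v) (fun s => v1 s - / s)
    (fun r => lam * r * (exp (dev v r) - exp (- dev v r)) - (v1 r - / r) / r) d rho);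
    try lra.
  - intros x Hx. apply (dev_continuity_pt _ _ _ _ _ Hp). lra.
  - intros x Hx. apply (dev_derive _ _ _ _ _ Hp). lra.
  - intros x Hx. apply (dev_derive2 _ _ _ _ _ Hp). lra.
  - unfold dev.
    assert (v m <= v d) by (apply Hm; lra).
    assert (ln d <= v m); [|lra].
    rewrite <- (ln_exp (v m)). apply Rcomplements.ln_le; [easy|]. apply Rmin_r.
  - unfold dev. rewrite (profile_boundary _ _ _ _ Hp). lra.
  - intros x Hx Hneg Hcrit. rewrite Hcrit.
    assert (exp (dev v x) < exp (- dev v x)) by (apply exp_increasing; lra).
    assert (0 < lam * x) by (apply Rmult_lt_0_compat; lra).
    unfold Rdiv. rewrite Rmult_0_l. nra.
Qed.

(* [r v'] is nondecreasing; were it negative somewhere, [v] would blow up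
   logarithmically at the origin. *)
Lemma profile_derive_nonneg (rho lam : R) (v v1 : R -> R) (r : R) :
  is_profile rho lam v v1 -> 0 < lam -> 0 < r < rho -> 0 <= v1 r.
Proof.
  intros Hp Hlam Hr. apply Rnot_lt_le. intros Hneg.
  (* The derivative of [s * v1 s] is [s] times the right-hand side of the equation, which is
     nonnegative because [dev v] is. *)
  assert (Hmono : forall s, 0 < s <= r -> s * v1 s <= r * v1 r).
  { intros s Hs.
    apply (nonneg_derivative_le (fun s => s * v1 s)
      (fun s => 1 * v1 s
         + s * (lam * (exp (v s) - s ^ 2 * exp (- v s)) - v1 s / s))); [lra| | |].
    - intros x Hx. apply (Derive.is_derive_mult (fun s => s) v1).
      + apply (is_derive_id (K := R_AbsRing)).
      + apply (profile_equation _ _ _ _ Hp). lra.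
    - intros x Hx. apply continuity_pt_mult.
      + apply continuity_pt_id.
      + eapply is_derive_continuity_pt, (profile_equation _ _ _ _ Hp). lra.
    - intros x Hx.
      assert (Hw : 0 <= dev v x) by (apply (dev_nonneg rho lam v v1 x Hp); lra).
      replace (1 * v1 x + _) with (x * (lam * (exp (v x) - x ^ 2 * exp (- v x))))
        by (field; lra).
      rewrite exp_dev, exp_opp_dev by lra.
      assert (exp (- dev v x) <= exp (dev v x)).
      { destruct Hw as [Hw|<-]; [|rewrite Ropp_0; lra].
        left. apply exp_increasing. lra. }
      assert (0 <= exp (dev v x) - exp (- dev v x)) by lra.
      repeat (apply Rmult_le_pos; [lra|]). rewrite <- Rmult_minus_distr_l.
      apply Rmult_le_pos; lra. }
  set (D := r * v1 r) in *.
  assert (HD : D < 0) by (unfold D; nra).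
  destruct (continuity_ab_maj v 0 rho) as [m [Hm _]];
    [lra|intros; apply (profile_continuous _ _ _ _ Hp)|].
  (* Dividing [s * v1 s <= D] by [s] and integrating gives [v s >= v r + D * (ln s - ln r)],
     unbounded near 0 as [D < 0]. *)
  assert (Hlow : forall s, 0 < s <= r -> D * ln s - v s <= D * ln r - v r).
  { intros s Hs.
    apply (nonneg_derivative_le (fun s => D * ln s - v s)
      (fun s => D * / s - v1 s)); [lra| | |].
    - intros x Hx. apply (is_derive_minus (V := R_NormedModule)).
      + apply is_derive_scal, is_derive_ln. lra.
      + apply (profile_derive _ _ _ _ Hp). lra.
    - intros x Hx. apply continuity_pt_minus.
      + apply continuity_pt_scal.
        apply (is_derive_continuity_pt _ _ (/ x)), is_derive_ln. lra.
      + apply (profile_continuous _ _ _ _ Hp).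
    - intros x Hx. specialize (Hmono x).
      replace (D * / x - v1 x) with ((D - x * v1 x) * / x) by (field; lra).
      apply Rmult_le_pos; [lra|]. left. apply Rinv_0_lt_compat. lra. }
  (* Chosen so that [ln s <= K] forces [v s >= v m + 1], against the maximality of [v m]. *)
  set (K := (D * ln r - v r + v m + 1) / D).
  set (s := Rmin r (exp K)).
  assert (Hs : 0 < s <= r).
  { split; [apply Rmin_glb_lt; [lra|apply exp_pos]|apply Rmin_l]. }
  assert (Hln : ln s <= K).
  { rewrite <- (ln_exp K). apply Rcomplements.ln_le; [easy|]. apply Rmin_r. }
  specialize (Hlow s Hs).
  assert (v s <= v m) by (apply Hm; lra).
  assert (HK : D * K = D * ln r - v r + v m + 1) by (unfold K; field; lra).
  assert (D * K <= D * ln s) by nra.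
  lra.
Qed.

Lemma dev_le_ln (rho lam : R) (v v1 : R -> R) (r : R) :
  is_profile rho lam v v1 -> 0 < lam -> 0 < r <= rho -> dev v r <= ln rho - ln r.
Proof.
  intros Hp Hlam Hr. unfold dev. rewrite <- (profile_boundary _ _ _ _ Hp).
  assert (v r <= v rho); [|lra].
  apply (nonneg_derivative_le v v1); [lra| | |].
  - intros x Hx. apply (profile_derive _ _ _ _ Hp). lra.
  - intros x Hx. apply (profile_continuous _ _ _ _ Hp).
  - intros x Hx. apply (profile_derive_nonneg _ _ _ _ _ Hp); lra.
Qed.

(** The exponential is a supersolution: its second derivative is [a ^ 2] times itself, and
    [a ^ 2 <= lam * r] on the interval. The factor [ln 4] dominates the deviation at [rho / 4],
    where it is at most [ln rho - ln (rho / 4)]. *)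
Lemma dev_decay (rho lam a : R) (v v1 : R -> R) (r : R) :
  is_profile rho lam v v1 -> 0 < lam -> 0 < a -> a ^ 2 <= lam * (rho / 4) ->
  0 < rho -> rho / 4 <= r <= rho ->
  dev v r <= ln 4 * exp (- a * (r - rho / 4)).
Proof.
  intros Hp Hlam Ha Ha2 Hrho Hr.
  set (phi := fun r => ln 4 * exp (- a * (r - rho / 4))).
  assert (Hphi : forall x, is_derive phi x (- a * phi x)).
  { intros x. unfold phi. auto_derive; auto. unfold Rminus. ring. }
  assert (Hln4 : 0 < ln 4) by (rewrite <- ln_1; apply ln_increasing; lra).
  assert (Hphi0 : forall x, 0 < phi x).
  { intros x. apply Rmult_lt_0_compat; [easy|apply exp_pos]. }
  change (dev v r <= phi r).
  cut (0 <= phi r - dev v r); [lra|].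
  apply (minimum_principle (fun s => phi s - dev v s)
    (fun s => - a * phi s - (v1 s - / s))
    (fun r => - a * (- a * phi r) -
      (lam * r * (exp (dev v r) - exp (- dev v r)) - (v1 r - / r) / r))
    (rho / 4) rho); try lra.
  - intros x Hx. apply continuity_pt_minus.
    + eapply is_derive_continuity_pt, Hphi.
    + apply (dev_continuity_pt _ _ _ _ _ Hp). lra.
  - intros x Hx. apply (is_derive_minus (V := R_NormedModule)); [apply Hphi|].
    apply (dev_derive _ _ _ _ _ Hp). lra.
  - intros x Hx. apply (is_derive_minus (V := R_NormedModule)).
    + apply is_derive_scal, Hphi.
    + apply (dev_derive2 _ _ _ _ _ Hp). lra.
  - assert (dev v (rho / 4) <= ln rho - ln (rho / 4))
      by (apply (dev_le_ln _ _ _ _ _ Hp); lra).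
    rewrite Rcomplements.ln_div in H by lra.
    unfold phi. replace (- a * (rho / 4 - rho / 4)) with 0 by ring.
    rewrite exp_0. lra.
  - generalize (Hphi0 rho). unfold dev at 1.
    rewrite (profile_boundary _ _ _ _ Hp). lra.
  (* Where [dev v x > phi x > 0], [exp w - exp (- w) > w > phi x] for [w = dev v x]. At a critical
     point the first-order term equals [- (a * phi x / x)], which has the favourable sign. *)
  - intros x Hx Hneg Hcrit.
    assert (E : v1 x - / x = - a * phi x) by lra. rewrite E.
    specialize (Hphi0 x).
    generalize (exp_ineq1_le (dev v x)). intros H1.
    assert (H2 : exp (- dev v x) < 1) by (rewrite <- exp_0; apply exp_increasing; lra).
    assert (H3 : 0 < a * phi x / x).
    { apply Rdiv_lt_0_compat; [|lra]. now apply Rmult_lt_0_compat. }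
    replace (- a * phi x / x) with (- (a * phi x / x)) by (field; lra).
    assert (H4 : lam * (rho / 4) <= lam * x) by (apply Rmult_le_compat_l; lra).
    assert (H5 : lam * x * phi x < lam * x * (exp (dev v x) - exp (- dev v x))).
    { apply Rmult_lt_compat_l; [|lra]. apply Rmult_lt_0_compat; lra. }
    assert (H6 : a ^ 2 * phi x <= lam * x * phi x) by (apply Rmult_le_compat_r; lra).
    nra.
Qed.

(** * Regularity up to the boundary radius *)

Lemma D_in_eq (f d d' : R -> R) (D : R -> Prop) (x : R) :
  D_in f d D x -> d x = d' x -> D_in f d' D x.
Proof. intros H E. unfold D_in. rewrite <- E. exact H. Qed.

Lemma D_in_subset (f d : R -> R) (D D' : R -> Prop) (x : R) :
  (forall y, D y -> D' y) -> D_in f d D' x -> D_in f d D x.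
Proof.
  intros Hs H e He. destruct (H e He) as [al [Hal Hb]].
  exists al; split; [easy|]. intros y [[Hy Hne] Hd]. apply Hb.
  repeat split; auto.
Qed.

Lemma is_derive_D_in (f d : R -> R) (D : R -> Prop) (x : R) :
  is_derive f x (d x) -> D_in f d D x.
Proof.
  intros H. apply (D_in_subset f d D no_cond x); [easy|].
  now apply derivable_pt_lim_D_in, is_derive_Reals.
Qed.

Lemma is_derive_comp_D_in (g dg f df : R -> R) (D : R -> Prop) (x : R) :
  is_derive g (f x) (dg (f x)) -> D_in f df D x ->
  D_in (fun y => g (f y)) (fun y => df y * dg (f y)) D x.
Proof.
  intros Hg Hf.
  apply (D_in_subset _ _ D (Dgf D no_cond f)); [now split|].
  apply Dcomp; [easy|]. now apply is_derive_D_in.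
Qed.

Lemma continuous_on_of_D_in (f d : R -> R) (D : R -> Prop) :
  (forall x, D x -> D_in f d D x) -> continuous_on D f.
Proof.
  intros H x Hx. apply filterlim_locally. intros e.
  destruct (cont_deriv _ _ _ _ (H x Hx) e (cond_pos e)) as [al [Hal Hb]].
  exists (mkposreal al Hal). intros y Hy HDy.
  destruct (Req_dec x y) as [<-|Hne]; [apply ball_center|].
  apply Hb. split; [split; auto|exact Hy].
Qed.

(** The mean value theorem turns each difference quotient into a value of [g] nearer to [x], so
    continuity of [g] suffices. This supplies the one-sided derivative at an endpoint, where no
    derivative of [f] is assumed. *)
Lemma D_in_of_interior_derive (f g : R -> R) (a b x : R) :
  a <= x <= b ->
  (forall y, a <= y <= b -> continuity_pt f y) ->
  (forall y, a < y < b -> is_derive f y (g y)) ->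
  continuity_pt g x ->
  D_in f g (fun y => a <= y <= b) x.
Proof.
  intros Hx Hc Hd Hg e He.
  destruct (Hg e He) as [al [Hal Hb]].
  exists al; split; [easy|]. intros y [[Hy Hne] Hdist].
  assert (Hcl : forall c, Rmin x y < c < Rmax x y -> Rabs (c - x) <= Rabs (y - x)).
  { intros c. unfold Rmin, Rmax. destruct (Rle_dec x y); intros Hcxy.
    - rewrite 2!Rabs_pos_eq; lra.
    - rewrite 2!Rabs_left1; lra. }
  assert (Hex : exists c, Rabs (c - x) <= Rabs (y - x) /\
                          (f y - f x) / (y - x) = g c).
  { destruct (Rtotal_order x y) as [H|[H|H]]; [|lra|].
    - destruct (strict_MVT f g x y) as [c [Hcxy E]]; [easy| | |].
      + intros z Hz. apply Hd. lra.
      + intros z Hz. apply Hc. lra.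
      + exists c; split.
        * apply Hcl. rewrite Rmin_left, Rmax_right; lra.
        * rewrite E. field. lra.
    - destruct (strict_MVT f g y x) as [c [Hcxy E]]; [easy| | |].
      + intros z Hz. apply Hd. lra.
      + intros z Hz. apply Hc. lra.
      + exists c; split.
        * apply Hcl. rewrite Rmin_right, Rmax_left; lra.
        * replace (f y - f x) with (- (f x - f y)) by ring. rewrite E. field. lra. }
  destruct Hex as [c [Hcx ->]].
  destruct (Req_dec x c) as [<-|Hxc].
  - rewrite (proj2 (dist_refl R_met _ _)); easy.
  - apply Hb. split; [split; [easy|easy]|].
    simpl in *. unfold Rdist in *. lra.
Qed.

(** The derivative of [r v'], by the radial equation. *)
Definition source (lam : R) (v : R -> R) (r : R) : R :=
  lam * r * (exp (v r) - r ^ 2 * exp (- v r)).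

(* Equal to [r v' - 1] in the open interval, but also defined and smooth at the
   boundary radius, where [v'] itself is not given. *)
Definition flux (rho lam : R) (v v1 : R -> R) (r : R) : R :=
  rho / 2 * v1 (rho / 2) - 1 + RInt (source lam v) (rho / 2) r.

(** The continuation of [w' = v' - 1/r] up to and past the boundary radius. *)
Definition slope (rho lam : R) (v v1 : R -> R) (r : R) : R :=
  flux rho lam v v1 r / r.

Lemma source_dev (lam : R) (v : R -> R) (r : R) :
  0 < r -> source lam v r = lam * r ^ 2 * (exp (dev v r) - exp (- dev v r)).
Proof.
  intros Hr. unfold source. rewrite exp_dev, exp_opp_dev by easy. ring.
Qed.

Lemma source_continuous (rho lam : R) (v v1 : R -> R) (r : R) :
  is_profile rho lam v v1 -> continuous (source lam v) r.
Proof.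
  intros Hp. apply continuity_pt_filterlim. unfold source.
  pose proof (profile_continuous _ _ _ _ Hp r) as Hv.
  assert (He : forall x, continuity_pt exp x)
    by (intros; apply derivable_continuous, derivable_exp).
  assert (Hp1 : forall n, continuity_pt (fun r => r ^ n) r)
    by (intros; apply derivable_continuous, derivable_pow).
  apply continuity_pt_mult.
  - apply continuity_pt_scal, continuity_pt_id.
  - apply continuity_pt_minus.
    + apply (continuity_pt_comp v exp); auto.
    + apply continuity_pt_mult; [apply Hp1|].
      apply (continuity_pt_comp (fun r => - v r) exp); [|auto].
      now apply continuity_pt_opp.
Qed.

Lemma flux_derive (rho lam : R) (v v1 : R -> R) (r : R) :
  is_profile rho lam v v1 -> is_derive (flux rho lam v v1) r (source lam v r).
Proof.
  intros Hp. unfold flux.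
  replace (source lam v r) with (plus 0 (source lam v r)) by apply Rplus_0_l.
  apply (is_derive_plus (V := R_NormedModule)); [apply (is_derive_const (V := R_NormedModule))|].
  apply (is_derive_RInt _ _ (rho / 2)).
  - apply filter_forall. intros x. apply (RInt_correct (V := R_CompleteNormedModule)).
    apply (ex_RInt_continuous (V := R_CompleteNormedModule)).
    intros z _. eapply source_continuous, Hp.
  - eapply source_continuous, Hp.
Qed.

Lemma flux_eq (rho lam : R) (v v1 : R -> R) (r : R) :
  is_profile rho lam v v1 -> 0 < r < rho -> flux rho lam v v1 r = r * v1 r - 1.
Proof.
  intros Hp Hr.
  (* Both sides have derivative [source], so their difference is constant; at [rho / 2] the integral
     vanishes and the difference is -1. *)
  assert (Hd : forall x, 0 < x < rho ->
    is_derive (fun s => flux rho lam v v1 s - s * v1 s) x 0).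
  { intros x Hx.
    replace 0 with (source lam v x - (1 * v1 x
         + x * (lam * (exp (v x) - x ^ 2 * exp (- v x)) - v1 x / x)))
      by (unfold source; field; lra).
    apply (is_derive_minus (V := R_NormedModule)); [now apply flux_derive|].
    apply (Derive.is_derive_mult (fun s => s) v1).
    - apply (is_derive_id (K := R_AbsRing)).
    - now apply (profile_equation _ _ _ _ Hp). }
  assert (Hmid : 0 < Rmin (rho / 2) r /\ Rmax (rho / 2) r < rho).
  { split; [apply Rmin_glb_lt|apply Rmax_lub_lt]; lra. }
  destruct (MVT_gen (fun s => flux rho lam v v1 s - s * v1 s) (rho / 2) r (fun _ => 0))
    as [c [_ E]].
  - intros x Hx. apply Hd. lra.
  - intros x Hx. eapply is_derive_continuity_pt, Hd. lra.
  - unfold flux at 2 in E. rewrite RInt_point in E. unfold zero in E; simpl in E. lra.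
Qed.

Lemma slope_eq (rho lam : R) (v v1 : R -> R) (r : R) :
  is_profile rho lam v v1 -> 0 < r < rho -> slope rho lam v v1 r = v1 r - / r.
Proof.
  intros Hp Hr. unfold slope. rewrite (flux_eq _ _ _ _ _ Hp Hr). field. lra.
Qed.

(** Holds at [rho] too, because [flux] is the integral of a function continuous on the whole
    line. *)
Lemma slope_derive (rho lam : R) (v v1 : R -> R) (r : R) :
  is_profile rho lam v v1 -> 0 < r ->
  is_derive (slope rho lam v v1) r
    (lam * r * (exp (dev v r) - exp (- dev v r)) - slope rho lam v v1 r / r).
Proof.
  intros Hp Hr.
  replace (lam * r * _ - _) with
    ((source lam v r * r - flux rho lam v v1 r * 1) / r ^ 2).
  - apply is_derive_div; [now apply flux_derive| |lra].
    apply (is_derive_id (K := R_AbsRing)).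
  - rewrite source_dev by easy. unfold slope. field. lra.
Qed.

Lemma dev_D_in (rho lam a : R) (v v1 : R -> R) (r : R) :
  is_profile rho lam v v1 -> 0 < a -> a <= r <= rho ->
  D_in (dev v) (slope rho lam v v1) (fun x => a <= x <= rho) r.
Proof.
  intros Hp Ha Hr. apply D_in_of_interior_derive; [easy| | |].
  - intros y Hy. apply (dev_continuity_pt _ _ _ _ _ Hp). lra.
  - intros y Hy. rewrite (slope_eq _ _ _ _ _ Hp) by lra.
    apply (dev_derive _ _ _ _ _ Hp). lra.
  - eapply is_derive_continuity_pt, slope_derive; [exact Hp|lra].
Qed.

(** Write the difference as [exp w * (1 - exp (- (2 * w)))]; the first factor is at most 4 and the
    second at most [2 * w]. *)
Lemma exp_minus_exp_opp_bounds (w h : R) :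
  0 <= w <= h -> w <= ln 4 -> 0 <= exp w - exp (- w) <= 8 * h.
Proof.
  intros Hw H4.
  assert (E4 : exp w <= 4).
  { rewrite <- (exp_ln 4) by lra. destruct H4 as [H| ->]; [left; now apply exp_increasing|lra]. }
  assert (H1 : exp (- w) = exp w * exp (- (2 * w))).
  { rewrite <- exp_plus. f_equal. ring. }
  generalize (exp_ineq1_le (- (2 * w))) (exp_pos w). intros H2 H3.
  assert (H5 : exp w * (1 - exp (- (2 * w))) <= exp w * (2 * w))
    by (apply Rmult_le_compat_l; lra).
  assert (H6 : exp w * (2 * w) <= 4 * (2 * w)) by (apply Rmult_le_compat_r; lra).
  assert (H7 : exp (- w) <= exp w).
  { destruct (proj1 Hw) as [H|<-]; [left; apply exp_increasing; lra|rewrite Ropp_0; lra]. }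
  lra.
Qed.

(* The mean value theorem for [w] on [3 rho/8, rho/2] gives one point where the
   flux is small; its derivative is small from there up to the boundary. *)
Lemma slope_bound (rho lam h : R) (v v1 : R -> R) (r : R) :
  is_profile rho lam v v1 -> 0 < lam -> 0 < rho ->
  (forall s, 3 / 8 * rho <= s <= rho -> dev v s <= h) ->
  rho / 2 <= r <= rho ->
  Rabs (slope rho lam v v1 r) <= (16 / rho + 16 * lam * rho ^ 2) * h.
Proof.
  intros Hp Hlam Hrho Hh Hr.
  assert (H0 : forall s, 3 / 8 * rho <= s <= rho -> 0 <= dev v s).
  { intros s Hs. apply (dev_nonneg _ _ _ _ _ Hp); lra. }
  assert (Hh0 : 0 <= h).
  { specialize (H0 rho). specialize (Hh rho). lra. }
  assert (HS : forall s, 3 / 8 * rho <= s <= rho ->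
    0 <= exp (dev v s) - exp (- dev v s) <= 8 * h).
  { intros s Hs. apply exp_minus_exp_opp_bounds; [split; auto|].
    apply Rle_trans with (ln rho - ln s); [apply (dev_le_ln _ _ _ _ _ Hp); lra|].
    rewrite <- Rcomplements.ln_div by lra. apply Rcomplements.ln_le.
    - apply Rdiv_lt_0_compat; lra.
    - apply Rmult_le_reg_r with s; [lra|]. field_simplify; lra. }
  destruct (strict_MVT (dev v) (fun s => v1 s - / s) (3 / 8 * rho) (rho / 2))
    as [xi [Hxi E]]; [lra| | |].
  { intros x Hx. apply (dev_derive _ _ _ _ _ Hp). lra. }
  { intros x Hx. apply (dev_continuity_pt _ _ _ _ _ Hp). lra. }
  (* The flux at [xi] is [xi] times the derivative of the deviation, a difference of two values in
     [[0, h]] divided by [rho / 8]; and [xi / (rho / 8) <= 8]. *)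
  assert (Hfxi : Rabs (flux rho lam v v1 xi) <= 8 * h).
  { rewrite (flux_eq _ _ _ _ _ Hp) by lra.
    replace (xi * v1 xi - 1) with (xi / (rho / 8) * (dev v (rho / 2) - dev v (3 / 8 * rho)))
      by (rewrite E; field; lra).
    rewrite Rabs_mult. rewrite (Rabs_pos_eq (xi / (rho / 8))).
    - apply Rmult_le_compat; [left; apply Rdiv_lt_0_compat; lra|apply Rabs_pos| |].
      + apply Rmult_le_reg_r with (rho / 8); [lra|]. field_simplify; lra.
      + apply Rabs_le.
        generalize (H0 (rho / 2)) (H0 (3 / 8 * rho)) (Hh (rho / 2)) (Hh (3 / 8 * rho)).
        lra.
    - left; apply Rdiv_lt_0_compat; lra. }
  destruct (strict_MVT (flux rho lam v v1) (source lam v) xi r) as [c [Hc Ef]]; [lra| | |].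
  { intros x _. now apply flux_derive. }
  { intros x _. eapply is_derive_continuity_pt. now apply flux_derive. }
  assert (Hs : 0 <= source lam v c * (r - xi) <= lam * rho ^ 2 * (8 * h) * rho).
  { rewrite source_dev by lra.
    assert (0 <= c ^ 2 <= rho ^ 2) by nra.
    destruct (HS c) as [HS1 HS2]; [lra|].
    assert (0 <= lam * c ^ 2) by (apply Rmult_le_pos; lra).
    split.
    - apply Rmult_le_pos; [|lra]. apply Rmult_le_pos; lra.
    - apply Rmult_le_compat; [apply Rmult_le_pos; lra|lra| |lra].
      apply Rmult_le_compat; try lra. apply Rmult_le_compat_l; lra. }
  assert (Hf : Rabs (flux rho lam v v1 r) <= 8 * h + lam * rho ^ 2 * (8 * h) * rho).
  { replace (flux rho lam v v1 r)
      with (flux rho lam v v1 xi + source lam v c * (r - xi)) by lra.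
    eapply Rle_trans; [apply Rabs_triang|]. rewrite (Rabs_pos_eq (_ * _)); lra. }
  unfold slope, Rdiv. rewrite Rabs_mult, (Rabs_pos_eq (/ r));
    [|left; apply Rinv_0_lt_compat; lra].
  (* Division by [r >= rho / 2] turns the flux bound into the stated constants. *)
  replace ((16 * / rho + 16 * lam * rho ^ 2) * h)
    with ((8 * h + lam * rho ^ 2 * (8 * h) * rho) * / (rho / 2)) by (field; lra).
  apply Rmult_le_compat; [apply Rabs_pos| |easy|].
  - left; apply Rinv_0_lt_compat; lra.
  - apply Rinv_le_contravar; lra.
Qed.

(** * Exponentially small families and higher derivatives *)

Definition exp_small (a b : R) (f : R -> R -> R) : Prop :=
  exists C c, 0 < C /\ 0 < c /\
    forall eps x, 0 < eps < 1 -> a <= x <= b -> Rabs (f eps x) <= C * exp (- c / eps).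

(** Growth slower than every exponential in [1/eps]: multiplying by such a family costs only part of
    an exponential decay rate. *)
Definition subexp (a b : R) (f : R -> R -> R) : Prop :=
  forall d, 0 < d -> exists C, 0 < C /\
    forall eps x, 0 < eps < 1 -> a <= x <= b -> Rabs (f eps x) <= C * exp (d / eps).

Lemma exp_div_le (c d eps : R) : 0 < eps -> c <= d -> exp (c / eps) <= exp (d / eps).
Proof.
  intros He [H| ->]; [left|lra]. apply exp_increasing.
  apply Rmult_lt_compat_r; [now apply Rinv_0_lt_compat|easy].
Qed.

Lemma exp_small_add (a b : R) (f g : R -> R -> R) :
  exp_small a b f -> exp_small a b g -> exp_small a b (fun e x => f e x + g e x).
Proof.
  intros (C & c & HC & Hc & Hf) (C' & c' & HC' & Hc' & Hg).
  exists (C + C'), (Rmin c c'). repeat split; [lra|now apply Rmin_glb_lt|].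
  intros eps x He Hx. specialize (Hf eps x He Hx). specialize (Hg eps x He Hx).
  assert (H1 := exp_div_le (- c) (- Rmin c c') eps (proj1 He)
    (Ropp_le_contravar _ _ (Rmin_l c c'))).
  assert (H2 := exp_div_le (- c') (- Rmin c c') eps (proj1 He)
    (Ropp_le_contravar _ _ (Rmin_r c c'))).
  eapply Rle_trans; [apply Rabs_triang|]. nra.
Qed.

Lemma exp_small_mul (a b : R) (f g : R -> R -> R) :
  exp_small a b f -> subexp a b g -> exp_small a b (fun e x => f e x * g e x).
Proof.
  intros (C & c & HC & Hc & Hf) Hg.
  destruct (Hg (c / 2)) as (C' & HC' & Hg'); [lra|].
  exists (C * C'), (c / 2). repeat split; [now apply Rmult_lt_0_compat|lra|].
  intros eps x He Hx. specialize (Hf eps x He Hx). specialize (Hg' eps x He Hx).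
  rewrite Rabs_mult.
  replace (C * C' * exp (- (c / 2) / eps))
    with ((C * exp (- c / eps)) * (C' * exp (c / 2 / eps))).
  - apply Rmult_le_compat; auto using Rabs_pos.
  - replace (- (c / 2) / eps) with (- c / eps + c / 2 / eps) by (field; lra).
    rewrite exp_plus. ring.
Qed.

Lemma exp_small_ext (a b : R) (f g : R -> R -> R) :
  (forall e x, 0 < e < 1 -> a <= x <= b -> Rabs (g e x) <= Rabs (f e x)) ->
  exp_small a b f -> exp_small a b g.
Proof.
  intros H (C & c & HC & Hc & Hf). exists C, c. repeat split; auto.
  intros eps x He Hx. eapply Rle_trans; [now apply H|auto].
Qed.

Lemma subexp_add (a b : R) (f g : R -> R -> R) :
  subexp a b f -> subexp a b g -> subexp a b (fun e x => f e x + g e x).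
Proof.
  intros Hf Hg d Hd.
  destruct (Hf d Hd) as (C & HC & Hf'). destruct (Hg d Hd) as (C' & HC' & Hg').
  exists (C + C'). split; [lra|]. intros eps x He Hx.
  eapply Rle_trans; [apply Rabs_triang|].
  specialize (Hf' eps x He Hx). specialize (Hg' eps x He Hx). lra.
Qed.

Lemma subexp_mul (a b : R) (f g : R -> R -> R) :
  subexp a b f -> subexp a b g -> subexp a b (fun e x => f e x * g e x).
Proof.
  intros Hf Hg d Hd.
  destruct (Hf (d / 2)) as (C & HC & Hf'); [lra|].
  destruct (Hg (d / 2)) as (C' & HC' & Hg'); [lra|].
  exists (C * C'). split; [now apply Rmult_lt_0_compat|]. intros eps x He Hx.
  specialize (Hf' eps x He Hx). specialize (Hg' eps x He Hx). rewrite Rabs_mult.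
  replace (C * C' * exp (d / eps))
    with ((C * exp (d / 2 / eps)) * (C' * exp (d / 2 / eps))).
  - apply Rmult_le_compat; auto using Rabs_pos.
  - replace (d / eps) with (d / 2 / eps + d / 2 / eps) by (field; lra).
    rewrite exp_plus. ring.
Qed.

Lemma subexp_bounded (a b M : R) (f : R -> R -> R) :
  (forall e x, 0 < e < 1 -> a <= x <= b -> Rabs (f e x) <= M) -> subexp a b f.
Proof.
  intros H d Hd. exists (Rmax M 1).
  assert (HM := Rmax_r M 1). split; [lra|].
  intros eps x He Hx. specialize (H eps x He Hx).
  assert (H1 := Rmax_l M 1).
  assert (H2 := exp_ineq1_le (d / eps)).
  assert (0 < d / eps) by (apply Rdiv_lt_0_compat; lra).
  nra.
Qed.

Lemma exp_small_subexp (a b : R) (f : R -> R -> R) :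
  exp_small a b f -> subexp a b f.
Proof.
  intros (C & c & HC & Hc & Hf). apply (subexp_bounded a b C).
  intros eps x He Hx. eapply Rle_trans; [now apply Hf|].
  assert (exp (- c / eps) <= 1); [|nra].
  rewrite <- exp_0. replace 0 with (0 / eps) by (field; lra).
  apply exp_div_le; lra.
Qed.

(** [exp (d / eps)] is the square of [exp (d / 2 / eps)], hence at least [(d / 2 / eps)] squared. *)
Lemma subexp_inv_square (a b kappa : R) :
  subexp a b (fun eps _ => kappa / eps ^ 2).
Proof.
  (* The summand 1 keeps the constant positive when [kappa = 0]. *)
  intros d Hd. exists (Rabs kappa * (4 / d ^ 2) + 1).
  assert (H0 : 0 < 4 / d ^ 2) by (apply Rdiv_lt_0_compat; nra).
  assert (H1 := Rabs_pos kappa).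
  split; [nra|]. intros eps _ He _.
  assert (H2 : 0 < d / 2 / eps) by (repeat apply Rdiv_lt_0_compat; lra).
  assert (H3 := exp_ineq1_le (d / 2 / eps)).
  assert (H4 : (d / 2 / eps) * (d / 2 / eps) <= exp (d / eps)).
  { replace (d / eps) with (d / 2 / eps + d / 2 / eps) by (field; lra).
    rewrite exp_plus. apply Rmult_le_compat; lra. }
  assert (H5 : 0 < / eps ^ 2) by (apply Rinv_0_lt_compat, pow_lt; lra).
  unfold Rdiv at 1. rewrite Rabs_mult, (Rabs_pos_eq (/ eps ^ 2)) by lra.
  replace (/ eps ^ 2) with (4 / d ^ 2 * (d / 2 / eps * (d / 2 / eps))) by (field; lra).
  assert (H6 : 0 <= Rabs kappa * (4 / d ^ 2)) by nra.
  generalize (exp_pos (d / eps)). intros H7.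
  assert (Rabs kappa * (4 / d ^ 2) * (d / 2 / eps * (d / 2 / eps))
    <= Rabs kappa * (4 / d ^ 2) * exp (d / eps)) by now apply Rmult_le_compat_l.
  lra.
Qed.

(* Differential polynomials in a solution of [w' = q],
   [q' = lam r (e^w - e^-w) - q/r]; [JS] and [JT] stand for [e^w - e^-w] and
   [e^w + e^-w]. *)
Inductive jet : Type :=
| JW | JQ | JS | JT | JR | JInv | JLam
| JConst (c : R)
| JAdd (e f : jet)
| JMul (e f : jet).

Fixpoint jet_eval (lam : R) (w q : R -> R) (e : jet) (x : R) : R :=
  match e with
  | JW => w x
  | JQ => q x
  | JS => exp (w x) - exp (- w x)
  | JT => exp (w x) + exp (- w x)
  | JR => x
  | JInv => / x
  | JLam => lam
  | JConst c => c
  | JAdd e f => jet_eval lam w q e x + jet_eval lam w q f x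
  | JMul e f => jet_eval lam w q e x * jet_eval lam w q f x
  end.

Fixpoint jet_diff (e : jet) : jet :=
  match e with
  | JW => JQ
  | JQ => JAdd (JMul (JMul JLam JR) JS) (JMul (JConst (-1)) (JMul JQ JInv))
  | JS => JMul JQ JT
  | JT => JMul JQ JS
  | JR => JConst 1
  | JInv => JMul (JConst (-1)) (JMul JInv JInv)
  | JLam => JConst 0
  | JConst _ => JConst 0
  | JAdd e f => JAdd (jet_diff e) (jet_diff f)
  | JMul e f => JAdd (JMul (jet_diff e) f) (JMul e (jet_diff f))
  end.

(* Membership in the ideal generated by [JW], [JQ], [JS]; it is stable under
   [jet_diff], and its elements are the exponentially small jets. *)
Fixpoint jet_ideal (e : jet) : Prop :=
  match e with
  | JW | JQ | JS => True
  | JT | JR | JInv | JLam | JConst _ => False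
  | JAdd e f => jet_ideal e /\ jet_ideal f
  | JMul e f => jet_ideal e \/ jet_ideal f
  end.

(** Each generator has its derivative in the ideal, and in the Leibniz rule both summands keep a
    factor in it. *)
Lemma jet_ideal_diff (e : jet) : jet_ideal e -> jet_ideal (jet_diff e).
Proof. induction e; simpl; tauto. Qed.

(** Derivatives are relative to [D] because at the boundary radius [w] is controlled from inside
    only. *)
Lemma jet_D_in (lam : R) (w q : R -> R) (D : R -> Prop) (x : R) (e : jet) :
  x <> 0 ->
  D_in w q D x ->
  D_in q (fun y => lam * y * (exp (w y) - exp (- w y)) - q y / y) D x ->
  D_in (jet_eval lam w q e) (jet_eval lam w q (jet_diff e)) D x.
Proof.
  intros Hx Hw Hq.
  assert (HS : D_in (fun y => exp (w y) - exp (- w y))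
                 (fun y => q y * (exp (w y) + exp (- w y))) D x).
  { apply (is_derive_comp_D_in (fun t => exp t - exp (- t))
      (fun t => exp t + exp (- t))); [|easy]. auto_derive; [easy|ring]. }
  assert (HT : D_in (fun y => exp (w y) + exp (- w y))
                 (fun y => q y * (exp (w y) - exp (- w y))) D x).
  { apply (is_derive_comp_D_in (fun t => exp t + exp (- t))
      (fun t => exp t - exp (- t))); [|easy]. auto_derive; [easy|ring]. }
  induction e; simpl; auto using Dconst.
  - eapply D_in_eq; [exact Hq|]. simpl. field. easy.
  - apply Dx.
  - apply is_derive_D_in. auto_derive; [easy|]. field. easy.
  - now apply Dadd.
  - now apply Dmult.
Qed.

Lemma jet_subexp (a b : R) (lam : R -> R) (w q : R -> R -> R) (e : jet) :
  0 < a ->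
  subexp a b (fun eps _ => lam eps) ->
  exp_small a b w -> exp_small a b q ->
  exp_small a b (fun eps x => exp (w eps x) - exp (- w eps x)) ->
  subexp a b (fun eps x => exp (w eps x) + exp (- w eps x)) ->
  subexp a b (fun eps => jet_eval (lam eps) (w eps) (q eps) e).
Proof.
  intros Ha Hlam Hw Hq HS HT.
  induction e; simpl; auto using exp_small_subexp, subexp_add, subexp_mul.
  - apply (subexp_bounded a b b). intros _ x _ Hx. rewrite Rabs_pos_eq; lra.
  - apply (subexp_bounded a b (/ a)). intros _ x _ Hx.
    rewrite Rabs_pos_eq by (left; apply Rinv_0_lt_compat; lra).
    apply Rinv_le_contravar; lra.
  - apply (subexp_bounded a b (Rabs c)). intros; lra.
Qed.

(** In a product one factor lies in the ideal and is exponentially small; the other need only be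
    subexponential, as every jet is. *)
Lemma jet_exp_small (a b : R) (lam : R -> R) (w q : R -> R -> R) (e : jet) :
  0 < a ->
  subexp a b (fun eps _ => lam eps) ->
  exp_small a b w -> exp_small a b q ->
  exp_small a b (fun eps x => exp (w eps x) - exp (- w eps x)) ->
  subexp a b (fun eps x => exp (w eps x) + exp (- w eps x)) ->
  jet_ideal e ->
  exp_small a b (fun eps => jet_eval (lam eps) (w eps) (q eps) e).
Proof.
  intros Ha Hlam Hw Hq HS HT.
  induction e as [| | | | | | | |e1 IH1 e2 IH2|e1 IH1 e2 IH2]; simpl;
    try tauto; intros Hi.
  - apply exp_small_add; tauto.
  - destruct Hi as [Hi|Hi].
    + apply exp_small_mul; [auto|now apply jet_subexp].
    + apply exp_small_ext with (fun eps x =>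
        jet_eval (lam eps) (w eps) (q eps) e2 x * jet_eval (lam eps) (w eps) (q eps) e1 x).
      * intros. rewrite Rmult_comm. lra.
      * apply exp_small_mul; [auto|now apply jet_subexp].
Qed.

(** * The C^k norm of the deviation *)

Lemma Rabs_sup_exists (a b M : R) (f : R -> R) :
  a <= b -> (forall x, a <= x <= b -> Rabs (f x) <= M) ->
  exists s, is_lub (fun y => exists x, a <= x <= b /\ y = Rabs (f x)) s /\ s <= M.
Proof.
  intros Hab HM.
  assert (Hub : is_upper_bound (fun y => exists x, a <= x <= b /\ y = Rabs (f x)) M).
  { intros y (x & Hx & ->). auto. }
  destruct (completeness (fun y => exists x, a <= x <= b /\ y = Rabs (f x)))
    as [s Hs].
  - now exists M.
  - exists (Rabs (f a)), a. split; [lra|easy].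
  - exists s. split; [easy|]. now apply Hs.
Qed.

(** Induction on [k]: constants add and the smaller rate survives, so [C] and [c] are fixed before
    [eps]. *)
Lemma sup_sum_bound (a b : R) (g : R -> nat -> R -> R) (k : nat) :
  a <= b ->
  (forall j, exp_small a b (fun eps => g eps j)) ->
  exists C c, 0 < C /\ 0 < c /\
    forall eps, 0 < eps < 1 -> exists s : nat -> R,
      (forall j, (j <= k)%nat ->
        is_lub (fun y => exists x, a <= x <= b /\ y = Rabs (g eps j x)) (s j)) /\
      sum_f_R0 s k <= C * exp (- c / eps).
Proof.
  intros Hab Hg. induction k as [|k IH].
  - destruct (Hg 0%nat) as (C & c & HC & Hc & H). exists C, c. repeat split; auto.
    intros eps He.
    destruct (Rabs_sup_exists a b (C * exp (- c / eps)) (g eps 0%nat)) as (s & Hs & Hle);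
      [easy|now auto|].
    exists (fun _ => s). split; [|easy].
    intros j Hj. now replace j with 0%nat by lia.
  - destruct IH as (C & c & HC & Hc & H).
    destruct (Hg (S k)) as (C' & c' & HC' & Hc' & H').
    exists (C + C'), (Rmin c c'). repeat split; [lra|now apply Rmin_glb_lt|].
    intros eps He.
    destruct (H eps He) as (s & Hs & Hle).
    destruct (Rabs_sup_exists a b (C' * exp (- c' / eps)) (g eps (S k)))
      as (s' & Hs' & Hle'); [easy|now auto|].
    exists (fun j => if Nat.leb j k then s j else s'). split.
    + intros j Hj. destruct (Nat.leb_spec j k); [auto|].
      now replace j with (S k) by lia.
    + rewrite tech5, (proj2 (Nat.leb_gt (S k) k)) by lia.
      rewrite (sum_eq _ s) by (intros i Hi; now rewrite (proj2 (Nat.leb_le i k))).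
      assert (H1 := exp_div_le (- c) (- Rmin c c') eps (proj1 He)
        (Ropp_le_contravar _ _ (Rmin_l c c'))).
      assert (H2 := exp_div_le (- c') (- Rmin c c') eps (proj1 He)
        (Ropp_le_contravar _ _ (Rmin_r c c'))).
      nra.
Qed.

Fixpoint jet_iter_diff (e : jet) (j : nat) : jet :=
  match j with
  | O => e
  | S j => jet_diff (jet_iter_diff e j)
  end.

Lemma jet_ideal_iter_diff (e : jet) (j : nat) :
  jet_ideal e -> jet_ideal (jet_iter_diff e j).
Proof. intros He. induction j; simpl; auto using jet_ideal_diff. Qed.

(** The interval starts at [3 / 8 * rho], before [rho / 2], to leave room for the mean value
    argument in [slope_bound]. *)
Lemma dev_exp_small (rho kappa : R) (v v1 : R -> R -> R) :
  0 < rho -> 0 < kappa ->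
  (forall eps, 0 < eps -> is_profile rho (kappa / eps ^ 2) (v eps) (v1 eps)) ->
  exp_small (3 / 8 * rho) rho (fun eps => dev (v eps)).
Proof.
  intros Hrho Hkappa Hp.
  assert (Hk : 0 < kappa * (rho / 4)) by (apply Rmult_lt_0_compat; lra).
  (* Makes [a / eps] the largest rate that [dev_decay] allows for [lam = kappa / eps ^ 2]. *)
  set (a := sqrt (kappa * (rho / 4))).
  assert (Ha : 0 < a) by now apply sqrt_lt_R0.
  assert (Ha2 : a ^ 2 = kappa * (rho / 4)) by (apply pow2_sqrt; lra).
  (* On this interval [x - rho / 4 >= rho / 8]. *)
  exists (ln 4), (a * (rho / 8)). repeat split.
  - rewrite <- ln_1. apply ln_increasing; lra.
  - apply Rmult_lt_0_compat; lra.
  - intros eps x He Hx.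
    assert (Hl : 0 < kappa / eps ^ 2) by (apply Rdiv_lt_0_compat; [|apply pow_lt]; lra).
    assert (H0 : 0 <= dev (v eps) x).
    { apply (dev_nonneg rho (kappa / eps ^ 2) _ (v1 eps)); [apply Hp; lra|easy|lra]. }
    rewrite Rabs_pos_eq by easy.
    eapply Rle_trans.
    { apply (dev_decay rho (kappa / eps ^ 2) (a / eps) _ (v1 eps)); try lra.
      - apply Hp. lra.
      - apply Rdiv_lt_0_compat; lra.
      - replace ((a / eps) ^ 2) with (a ^ 2 / eps ^ 2) by (field; lra).
        rewrite Ha2. right. field. lra. }
    apply Rmult_le_compat_l; [rewrite <- ln_1; left; apply ln_increasing; lra|].
    replace (- (a / eps) * (x - rho / 4)) with ((- (a * (x - rho / 4))) / eps)
      by (field; lra).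
    apply exp_div_le; [lra|]. apply Ropp_le_contravar, Rmult_le_compat_l; lra.
Qed.

(** The factor [theta] converts a bound on [v] back to one on [u], where [v] is a multiple of
    [u]. *)
Lemma profile_Ck_norm_small (rho kappa theta : R) (v v1 : R -> R -> R) (k : nat) :
  0 < rho -> 0 < kappa ->
  (forall eps, 0 < eps -> is_profile rho (kappa / eps ^ 2) (v eps) (v1 eps)) ->
  exists C c, 0 < C /\ 0 < c /\
    forall eps, 0 < eps < 1 ->
      exists N, is_Ck_norm k (rho / 2) rho (fun r => theta * dev (v eps) r) N /\
        N <= C * exp (- c / eps).
Proof.
  intros Hrho Hkappa Hp.
  set (q := fun eps => slope rho (kappa / eps ^ 2) (v eps) (v1 eps)).
  assert (Hlam : forall eps, 0 < eps -> 0 < kappa / eps ^ 2).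
  { intros eps He. apply Rdiv_lt_0_compat; [|apply pow_lt]; lra. }
  destruct (dev_exp_small rho kappa v v1 Hrho Hkappa Hp) as (C & c & HC & Hc & Hdec).
  assert (H0 : forall eps x, 0 < eps < 1 -> rho / 2 <= x <= rho -> 0 <= dev (v eps) x <= ln 4).
  { intros eps x He Hx. split.
    - apply (dev_nonneg rho (kappa / eps ^ 2) _ (v1 eps)); [apply Hp|apply Hlam|]; lra.
    - apply Rle_trans with (ln rho - ln x).
      + apply (dev_le_ln rho (kappa / eps ^ 2) _ (v1 eps)); [apply Hp|apply Hlam|]; lra.
      + rewrite <- Rcomplements.ln_div by lra. apply Rcomplements.ln_le.
        * apply Rdiv_lt_0_compat; lra.
        * apply Rmult_le_reg_r with x; [lra|]. field_simplify; lra. }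
  assert (Hw : exp_small (rho / 2) rho (fun eps => dev (v eps))).
  { exists C, c. repeat split; auto. intros. apply Hdec; lra. }
  assert (Hl := subexp_inv_square (rho / 2) rho kappa).
  assert (Hq : exp_small (rho / 2) rho q).
  { apply exp_small_ext with (fun eps x =>
      C * exp (- c / eps) * (16 / rho + 16 * (rho ^ 2 * (kappa / eps ^ 2)))).
    - intros eps x He Hx.
      eapply Rle_trans; [|apply Rle_abs].
      eapply Rle_trans.
      + apply (slope_bound rho (kappa / eps ^ 2) (C * exp (- c / eps))); try easy.
        * apply Hp; lra.
        * apply Hlam; lra.
        * intros s Hs. eapply Rle_trans; [apply Rle_abs|]. now apply Hdec.
      + right. ring.
    - apply (exp_small_mul _ _ (fun eps _ => C * exp (- c / eps))
        (fun eps _ => 16 / rho + 16 * (rho ^ 2 * (kappa / eps ^ 2)))).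
      + exists C, c. repeat split; auto. intros. rewrite Rabs_pos_eq; [lra|].
        left. apply Rmult_lt_0_compat; [easy|apply exp_pos].
      + assert (Hcst : forall t, subexp (rho / 2) rho (fun _ _ => t)).
        { intros t. apply subexp_bounded with (Rabs t). intros; lra. }
        apply (subexp_add _ _ (fun _ _ => 16 / rho)); [apply Hcst|].
        apply (subexp_mul _ _ (fun _ _ => 16)); [apply Hcst|].
        apply (subexp_mul _ _ (fun _ _ => rho ^ 2)); [apply Hcst|exact Hl]. }
  assert (HS : exp_small (rho / 2) rho
    (fun eps x => exp (dev (v eps) x) - exp (- dev (v eps) x))).
  { apply exp_small_ext with (fun eps x => dev (v eps) x * 8).
    - intros eps x He Hx. specialize (H0 eps x He Hx).
      generalize (exp_minus_exp_opp_bounds (dev (v eps) x) (dev (v eps) x)).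
      intros H. rewrite 2!Rabs_pos_eq; lra.
    - apply exp_small_mul; [easy|]. apply subexp_bounded with (Rabs 8). intros; lra. }
  assert (HT : subexp (rho / 2) rho
    (fun eps x => exp (dev (v eps) x) + exp (- dev (v eps) x))).
  { apply subexp_bounded with (2 * exp (ln 4)). intros eps x He Hx.
    specialize (H0 eps x He Hx).
    assert (Hm : forall t, t <= ln 4 -> exp t <= exp (ln 4)).
    { intros t [Ht| ->]; [left; now apply exp_increasing|lra]. }
    generalize (Hm (dev (v eps) x)) (Hm (- dev (v eps) x)).
    generalize (exp_pos (dev (v eps) x)) (exp_pos (- dev (v eps) x)).
    intros. rewrite Rabs_pos_eq; lra. }
  (* The jet of the [j]-th derivative of [theta * w]. *)
  set (J := jet_iter_diff (JMul (JConst theta) JW)).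
  set (g := fun eps j => jet_eval (kappa / eps ^ 2) (dev (v eps)) (q eps) (J j)).
  destruct (sup_sum_bound (rho / 2) rho g k) as (C' & c' & HC' & Hc' & H); [lra| |].
  { intros j. apply jet_exp_small with (lam := fun eps => kappa / eps ^ 2); auto; [lra|].
    apply jet_ideal_iter_diff. simpl. auto. }
  exists C', c'. repeat split; auto. intros eps He.
  destruct (H eps He) as (s & Hs & Hle).
  exists (sum_f_R0 s k). split; [|easy].
  assert (HD : forall j x, rho / 2 <= x <= rho ->
    D_in (g eps j) (g eps (S j)) (fun x => rho / 2 <= x <= rho) x).
  { intros j x Hx. apply jet_D_in; [lra| |].
    - apply (dev_D_in rho _ (rho / 2)); [apply Hp|..]; lra.
    - apply is_derive_D_in, slope_derive; [apply Hp|]; lra. }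
  exists (g eps), s. split; [|now split].
  split; [easy|split; [now auto|]].
  (* The top derivative is continuous because it can be differentiated once more. *)
  apply (continuous_on_of_D_in _ (g eps (S k))). now apply HD.
Qed.

(** * Radial profiles of solutions in the disc *)

Lemma rad_0_r (x : R) : 0 <= x -> rad x 0 = x.
Proof.
  intros Hx. unfold rad. replace (x ^ 2 + 0 ^ 2) with (x ^ 2) by ring.
  now apply sqrt_pow2.
Qed.

Lemma rad_derive (x y : R) : 0 < x -> is_derive (rad x) y (y / rad x y).
Proof.
  intros Hx. assert (0 < x ^ 2 + y ^ 2) by nra.
  unfold rad. auto_derive; [nra|].
  replace (x * (x * 1) + y * (y * 1)) with (x ^ 2 + y ^ 2) by ring.
  field. apply Rgt_not_eq. now apply sqrt_lt_R0.
Qed.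

Lemma rad_between (x y : R) : 0 < x -> x <= rad x y <= x + Rabs y.
Proof.
  intros Hx. unfold rad. generalize (Rabs_pos y). intros Hy. split.
  - rewrite <- (sqrt_pow2 x) at 1 by lra. apply sqrt_le_1_alt. nra.
  - rewrite <- (sqrt_pow2 (x + Rabs y)) by lra. apply sqrt_le_1_alt.
    rewrite <- (pow2_abs y). nra.
Qed.

(** [is_profile] asks for continuity on the whole line, whereas a solution constrains [u] only on
    [[0, rho]]; composing with this truncation extends [u] continuously by constants. *)
Definition clamp (rho r : R) : R := Rmax 0 (Rmin r rho).

Lemma clamp_id (rho r : R) : 0 <= r <= rho -> clamp rho r = r.
Proof. intros Hr. unfold clamp. rewrite Rmin_left, Rmax_right; lra. Qed.

Lemma clamp_bounds (rho r : R) : 0 < rho -> 0 <= clamp rho r <= rho.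
Proof.
  intros Hrho. unfold clamp. split; [apply Rmax_l|].
  apply Rmax_lub; [lra|apply Rmin_r].
Qed.

Lemma clamp_lipschitz (rho r s : R) :
  Rabs (clamp rho r - clamp rho s) <= Rabs (r - s).
Proof.
  unfold clamp, Rmax, Rmin.
  repeat destruct Rle_dec; unfold Rabs; repeat destruct Rcase_abs; lra.
Qed.

Lemma locally_open_interval (a b x : R) : a < x < b -> locally x (fun y => a < y < b).
Proof.
  intros Hx. apply (locally_interval _ x a b); simpl; try lra.
  now intros y Hy1 Hy2.
Qed.

Lemma radial_clamp_continuous (rho b : R) (F : R -> R -> R) (u : R -> R) (r : R) :
  0 < rho -> radial_dirichlet_solution rho F b u ->
  continuity_pt (fun s => u (clamp rho s)) r.
Proof.
  intros Hrho Hu. apply continuity_pt_filterlim, filterlim_locally. intros e.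
  assert (Hc := clamp_bounds rho).
  assert (Hin : rad (fst (clamp rho r, 0)) (snd (clamp rho r, 0)) <= rho).
  { simpl. rewrite rad_0_r; now apply Hc. }
  destruct (cds_continuous _ _ _ _ Hu _ Hin _ (locally_ball _ e)) as [d Hd].
  exists d. intros s Hs.
  specialize (Hd (clamp rho s, 0)). simpl in Hd.
  rewrite 2!rad_0_r in Hd by now apply Hc.
  apply Hd; [|now apply Hc].
  split; [|apply ball_center]. simpl.
  eapply Rle_lt_trans; [apply clamp_lipschitz|exact Hs].
Qed.

Lemma radial_derive (rho b : R) (F : R -> R -> R) (u : R -> R) (r : R) :
  radial_dirichlet_solution rho F b u -> 0 < r < rho -> is_derive u r (Derive u r).
Proof.
  intros Hu Hr.
  destruct (cds_C2 _ _ _ _ Hu r 0) as [_ [Hd _]]; [rewrite rad_0_r; lra|].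
  apply Derive_correct. apply ex_derive_ext_loc with (2 := Hd).
  apply (filter_imp (fun y => 0 < y < rho)); [|now apply locally_open_interval].
  intros y Hy. now rewrite rad_0_r by lra.
Qed.

Lemma radial_Derive_axis (u : R -> R) (r : R) :
  0 < r -> Derive (fun x => u (rad x 0)) r = Derive u r.
Proof.
  intros Hr. apply Derive_ext_loc.
  apply (filter_imp (fun y => 0 < y < r + 1)); [|apply locally_open_interval; lra].
  intros y Hy. now rewrite rad_0_r by lra.
Qed.

(** The Laplacian is evaluated on the axis at [(r, 0)], where the second derivative in [x1] is [u'']
    and the one in [x2] is [u'/r]. *)
Lemma radial_derive2 (rho b : R) (F : R -> R -> R) (u : R -> R) (r : R) :
  radial_dirichlet_solution rho F b u -> 0 < r < rho ->
  is_derive (Derive u) r (F r (u r) - Derive u r / r).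
Proof.
  intros Hu Hr.
  assert (Hax : locally r (fun x => Derive (fun z => u (rad z 0)) x = Derive u x)).
  { apply (filter_imp (fun y => 0 < y < rho)); [|now apply locally_open_interval].
    intros y Hy. apply radial_Derive_axis. lra. }
  assert (Hd : ex_derive (Derive u) r).
  { destruct (cds_C2 _ _ _ _ Hu r 0) as [_ [_ [_ [[_ [Hd _]] _]]]];
      [rewrite rad_0_r; lra|].
    now apply ex_derive_ext_loc with (2 := Hd). }
  assert (H11 : partial_derive 2 0 (fun x1 x2 => u (rad x1 x2)) r 0 = Derive (Derive u) r).
  { unfold partial_derive. simpl. now apply Derive_ext_loc. }
  assert (H22 : partial_derive 0 2 (fun x1 x2 => u (rad x1 x2)) r 0 = Derive u r / r).
  { unfold partial_derive. simpl.
    (* Near [z = 0] the first derivative in [x2] is [u'] times [z / rad r z]; the second factor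
       vanishes at 0, so [u''] drops out of the next derivative. *)
    rewrite (Derive_ext_loc _ (fun z => Derive u (rad r z) * (z / rad r z))).
    - apply is_derive_unique.
      assert (E := rad_derive r 0 ltac:(lra)). rewrite rad_0_r in E by lra.
      assert (H1 : is_derive (fun z => Derive u (rad r z)) 0
                     (0 / r * Derive (Derive u) r)).
      { apply (is_derive_comp (Derive u) (rad r)); [|exact E].
        rewrite rad_0_r by lra. now apply Derive_correct. }
      assert (H2 : is_derive (fun z => z / rad r z) 0
                     ((1 * rad r 0 - 0 * (0 / r)) / rad r 0 ^ 2)).
      { apply is_derive_div.
        - apply (is_derive_id (K := R_AbsRing)).
        - exact E.
        - rewrite rad_0_r; lra. }
      replace (Derive u r / r) with
        (0 / r * Derive (Derive u) r * (0 / rad r 0)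
         + Derive u (rad r 0) * ((1 * rad r 0 - 0 * (0 / r)) / rad r 0 ^ 2))
        by (rewrite rad_0_r by lra; field; lra).
      now apply (Derive.is_derive_mult (fun z => Derive u (rad r z)) (fun z => z / rad r z)).
    (* For [Rabs z < rho - r], [rad r z <= r + Rabs z] stays below [rho]. *)
    - apply (filter_imp (fun z => - (rho - r) < z < rho - r));
        [|apply locally_open_interval; lra].
      intros z Hz. apply is_derive_unique.
      rewrite Rmult_comm. apply (is_derive_comp u (rad r)).
      + assert (Hb := rad_between r z ltac:(lra)).
        assert (Rabs z < rho - r) by (apply Rabs_def1; lra).
        apply (radial_derive _ _ _ _ _ Hu). lra.
      + apply rad_derive. lra. }
  assert (Heq := cds_equation _ _ _ _ Hu r 0 ltac:(rewrite rad_0_r; lra)).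
  unfold laplacian in Heq. rewrite H11, H22, rad_0_r in Heq by lra.
  replace (F r (u r) - Derive u r / r) with (Derive (Derive u) r) by lra.
  now apply Derive_correct.
Qed.

Lemma radial_is_profile (rho lam m b : R) (F : R -> R -> R) (u : R -> R) :
  0 < rho -> m * b = ln rho ->
  (forall r x, 0 < r -> m * F r x = lam * (exp (m * x) - r ^ 2 * exp (- (m * x)))) ->
  radial_dirichlet_solution rho F b u ->
  is_profile rho lam (fun r => m * u (clamp rho r)) (fun r => m * Derive u r).
Proof.
  intros Hrho Hb HF Hu. split.
  - intros x. apply continuity_pt_scal. now apply (radial_clamp_continuous rho b F).
  - intros r Hr. apply is_derive_scal.
    apply is_derive_ext_loc with u; [|now apply (radial_derive rho b F)].
    apply (filter_imp (fun y => 0 < y < rho)); [|now apply locally_open_interval].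
    intros y Hy. now rewrite clamp_id by lra.
  - intros r Hr. rewrite clamp_id by lra.
    rewrite <- HF by lra.
    replace (m * F r (u r) - m * Derive u r / r)
      with (m * (F r (u r) - Derive u r / r)) by (field; lra).
    now apply is_derive_scal, (radial_derive2 rho b F).
  - rewrite clamp_id by lra.
    assert (Hbd := cds_boundary _ _ _ _ Hu rho 0 (rad_0_r rho ltac:(lra))).
    simpl in Hbd. rewrite rad_0_r in Hbd by lra. now rewrite Hbd.
Qed.

(** * Transfer to the two Dirichlet problems *)

Lemma is_Ck_norm_ext (k : nat) (a b : R) (f f' : R -> R) (N : R) :
  (forall x, a <= x <= b -> f x = f' x) ->
  is_Ck_norm k a b f N -> is_Ck_norm k a b f' N.
Proof.
  intros E (g & s & (H0 & H1 & H2) & Hs & HN). exists g, s.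
  repeat split; auto; try apply Hs; auto.
  intros x Hx. rewrite <- E by easy. auto.
Qed.

(** Treats both problems at once through [v = m * u], with [m = 1] and [m = 2]. *)
Lemma radial_Ck_norm_small (rho kappa m : R) (b : R)
    (F : R -> R -> R -> R) (u : R -> R -> R) (k : nat) :
  0 < rho -> 0 < kappa -> 0 < m -> m * b = ln rho ->
  (forall eps r x, 0 < eps -> 0 < r ->
    m * F eps r x = kappa / eps ^ 2 * (exp (m * x) - r ^ 2 * exp (- (m * x)))) ->
  (forall eps, 0 < eps -> radial_dirichlet_solution rho (F eps) b (u eps)) ->
  exists C c, 0 < C /\ 0 < c /\
    exists eps0, 0 < eps0 /\
      forall eps, 0 < eps < eps0 ->
        exists N, is_Ck_norm k (rho / 2) rho (fun r => u eps r - / m * ln r) N /\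
          N <= C * exp (- c / eps).
Proof.
  intros Hrho Hkappa Hm Hb HF Hu.
  destruct (profile_Ck_norm_small rho kappa (/ m)
    (fun eps r => m * u eps (clamp rho r)) (fun eps r => m * Derive (u eps) r) k)
    as (C & c & HC & Hc & H); auto.
  { intros eps He. apply (radial_is_profile rho _ m b (F eps)); auto. }
  exists C, c. repeat split; auto. exists 1. split; [lra|].
  intros eps He. destruct (H eps He) as (N & HN & Hle). exists N. split; [|easy].
  apply is_Ck_norm_ext with (2 := HN).
  intros x Hx. unfold dev. rewrite clamp_id by lra. field. lra.
Qed.

Theorem proposition2p1 :
  (forall ubar : R -> R -> R,
     (forall eps, 0 < eps ->
        radial_dirichlet_solution 1
          (fun r v => / eps ^ 2 * (exp v - r ^ 2 * exp (- v)))
          0 (ubar eps)) ->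
     forall k : nat,
     exists C c : R, 0 < C /\ 0 < c /\
       exists eps0 : R, 0 < eps0 /\
         forall eps, 0 < eps < eps0 ->
           exists N : R,
             is_Ck_norm k (1 / 2) 1 (fun r => ubar eps r - ln r) N /\
             N <= C * exp (- c / eps))
  /\
  (forall r0 : R, 0 < r0 ->
     forall u : R -> R -> R,
     (forall eps, 0 < eps ->
        radial_dirichlet_solution (2 * r0)
          (fun r v => 4 * PI ^ 2 * / eps ^ 2
                      * (exp (2 * v) - r ^ 2 * exp (- (2 * v))))
          (1 / 2 * ln (2 * r0)) (u eps)) ->
     forall k : nat,
     exists C c : R, 0 < C /\ 0 < c /\
       exists eps0 : R, 0 < eps0 /\
         forall eps, 0 < eps < eps0 ->
           exists N : R,
             is_Ck_norm k r0 (2 * r0) (fun r => u eps r - 1 / 2 * ln r) N /\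
             N <= C * exp (- c / eps)).
Proof.
  split.
  - intros u Hu k.
    destruct (radial_Ck_norm_small 1 1 1 0
      (fun eps r v => / eps ^ 2 * (exp v - r ^ 2 * exp (- v))) u k)
      as (C & c & HC & Hc & eps0 & He0 & H); auto; try lra.
    + rewrite ln_1. ring.
    + intros. rewrite !Rmult_1_l. field. lra.
    + exists C, c. repeat split; auto. exists eps0. split; [easy|].
      intros eps He. destruct (H eps He) as (N & HN & Hle). exists N. split; [|easy].
      apply is_Ck_norm_ext with (2 := HN). intros x _. field.
  - intros r0 Hr0 u Hu k.
    (* Doubling [u] doubles the coefficient [4 * PI ^ 2], whence [8 * PI ^ 2]. *)
    destruct (radial_Ck_norm_small (2 * r0) (8 * PI ^ 2) 2 (1 / 2 * ln (2 * r0))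
      (fun eps r v => 4 * PI ^ 2 * / eps ^ 2
                      * (exp (2 * v) - r ^ 2 * exp (- (2 * v)))) u k)
      as (C & c & HC & Hc & eps0 & He0 & H); auto; try lra.
    + apply Rmult_lt_0_compat; [lra|]. apply pow_lt, PI_RGT_0.
    + intros. field. lra.
    + exists C, c. repeat split; auto. exists eps0. split; [easy|].
      intros eps He. destruct (H eps He) as (N & HN & Hle). exists N. split; [|easy].
      replace (2 * r0 / 2) with r0 in HN by field.
      apply is_Ck_norm_ext with (2 := HN). intros x _. field.
Qed.
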